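(* Consider the closed loop $\dot\zeta=\mathcal{A}\zeta+\mathcal{B}a$ and the notation described in the context, with $E_u$ and $C_S$ given and $n_1=n_2$. Assume that for every positive definite $P$, if the projection of $\mathcal{E}_P$ onto the $\zeta_1$-coordinates is contained in $\hat{\mathcal{E}}(R_\zeta,\bar\zeta)$, then $\mathcal{E}_P\subseteq\mathcal{E}(R_\zeta,\bar\zeta)$. Suppose there exist a positive definite matrix $R_a$, a tuple $\eta=(X,Y,\mathbf{A},\mathbf{B},\mathbf{C},\mathbf{D})$ and constants $\alpha,\beta,\delta\ge0$ that solve the optimization problem $$\min_{\eta,R_a,\alpha,\beta,\delta}\ \mathrm{Tr}[R_a]\quad\text{s.t.}\quad \mathbf{E}_2+\alpha\mathbf{F}+\beta\mathbf{S}\preceq0,\qquad P(\eta)\succ0,\qquad \mathbf{J}-\delta\mathbf{L}\preceq0.$$ Let $M,N\in\mathbb{R}^{n_1\times n_1}$ be nonsingular with $MN^\top=I-XY$, let the secondary controller matrices $(A_2,B_2,C_2,D_2)$ be those determined by $(\eta,M,N)$ through the change of variables in the context, and let $P=\Pi_2\Pi_1^{-1}$. Then, for the closed loop with this secondary controller, $\mathcal{E}_P=\{\zeta : \zeta^\top P\zeta\le1\}$ is a subset of the safe set $\mathcal{E}(R_\zeta,\bar\zeta)$ and is forward invariant for all attack signals satisfying $a^\top R_aa\le1$.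
   Context: Setting. The plant is $\dot x_p=A_px_p+B_pu$, $y=C_px_p$, with $x_p\in\mathbb{R}^{n_p}$, $u\in\mathbb{R}^{n_u}$, $y\in\mathbb{R}^{n_y}$. The given primary controller is $\dot x_1=A_1x_1+B_1(y+a_y)$, $u_P=C_1x_1+D_1(y+a_y)+a_u$, where $a=[a_u^\top\ a_y^\top]^\top\in\mathbb{R}^{n_u+n_y}$ is the attack signal. The secondary controller (to be designed) is $\dot x_2=A_2x_2+B_2y_S$, $u_S=C_2x_2+D_2y_S$, with $y_S=C_Sy$. The plant input is $u=u_P+E_uu_S$. All matrices are real and constant. Put $\zeta_1=[x_p^\top\ x_1^\top]^\top\in\mathbb{R}^{n_1}$, $x_2\in\mathbb{R}^{n_2}$ and $\zeta=[\zeta_1^\top\ x_2^\top]^\top$. The closed loop is $\dot\zeta=\mathcal{A}\zeta+\mathcal{B}a$ with $$\mathcal{A}=\begin{bmatrix}\mathcal{A}_1&\mathcal{A}_2\\ \mathcal{A}_3&\mathcal{A}_4\end{bmatrix}=\begin{bmatrix}\hat A+\hat BD_2\hat C&\hat BC_2\\ B_2\hat C&A_2\end{bmatrix},\quad \mathcal{B}=\begin{bmatrix}\mathcal{B}_1\\ \mathbf{0}\end{bmatrix},\quad \mathcal{B}_1=\begin{bmatrix}B_p&B_pD_1\\ \mathbf{0}&B_1\end{bmatrix},$$ $$\hat A=\begin{bmatrix}A_p+B_pD_1C_p&B_pC_1\\ B_1C_p&A_1\end{bmatrix},\quad \hat B=\begin{bmatrix}B_pE_u\\ \mathbf{0}\end{bmatrix},\quad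 \hat C=\begin{bmatrix}C_SC_p&\mathbf{0}\end{bmatrix}.$$ Safe set. $\mathcal{E}(R_\zeta,\bar\zeta)=\{\zeta : (\zeta-\bar\zeta)^\top R_\zeta(\zeta-\bar\zeta)\le1\}$ with $R_\zeta\succeq0$. $\hat{\mathcal{E}}(R_\zeta,\bar\zeta)$ is its projection onto the $\zeta_1$-coordinates, and $\hat R_\zeta\succ0$ is such that $\hat{\mathcal{E}}(R_\zeta,\bar\zeta)=\{\zeta_1 : (\zeta_1-\bar\zeta_1)^\top\hat R_\zeta(\zeta_1-\bar\zeta_1)\le1\}$, where $\bar\zeta_1$ is the $\zeta_1$-part of $\bar\zeta$. Matrices in the constraints. $\eta=(X,Y,\mathbf{A},\mathbf{B},\mathbf{C},\mathbf{D})$ with $X,Y\in\mathbb{R}^{n_1\times n_1}$ symmetric and $\mathbf{A},\mathbf{B},\mathbf{C},\mathbf{D}$ real of compatible sizes; $$P(\eta)=\begin{bmatrix}X&I\\ I&Y\end{bmatrix},\quad A(\eta)=\begin{bmatrix}\hat AX+\hat B\mathbf{C}&\hat A+\hat B\mathbf{D}\hat C\\ \mathbf{A}&Y\hat A+\mathbf{B}\hat C\end{bmatrix},\quad B(\eta)=\begin{bmatrix}\mathcal{B}_1\\ Y\mathcal{B}_1\end{bmatrix},$$ $$\mathbf{E}_2=\begin{bmatrix}A(\eta)^\top+A(\eta)&\mathbf{0}&B(\eta)\\ \mathbf{0}&0&\mathbf{0}\\ B(\eta)^\top&\mathbf{0}&\mathbf{0}\end{bmatrix},\quad \mathbf{F}=\begin{bmatrix}P(\eta)&\mathbf{0}&\mathbf{0}\\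 \mathbf{0}&-1&\mathbf{0}\\ \mathbf{0}&\mathbf{0}&\mathbf{0}\end{bmatrix},\quad \mathbf{S}=\begin{bmatrix}\mathbf{0}&\mathbf{0}&\mathbf{0}\\ \mathbf{0}&1&\mathbf{0}\\ \mathbf{0}&\mathbf{0}&-R_a\end{bmatrix},$$ $$\mathbf{J}=\begin{bmatrix}\mathbf{0}&-X\hat R_\zeta\bar\zeta_1&-X\\ -\bar\zeta_1^\top\hat R_\zeta X&\bar\zeta_1^\top\hat R_\zeta\bar\zeta_1-1&\mathbf{0}\\ -X&\mathbf{0}&-\hat R_\zeta^{-1}\end{bmatrix},\quad \mathbf{L}=\begin{bmatrix}X&\mathbf{0}&\mathbf{0}\\ \mathbf{0}&-1&\mathbf{0}\\ \mathbf{0}&\mathbf{0}&\mathbf{0}\end{bmatrix}.$$ Change of variables (case $n_1=n_2$). When $P(\eta)\succ0$, the matrix $I-XY$ is nonsingular, so nonsingular $M,N$ with $MN^\top=I-XY$ exist. Given such $M,N$, the matrices $(A_2,B_2,C_2,D_2)$ are the unique solution (found in the order $D_2,C_2,B_2,A_2$) of $$\mathbf{D}=D_2,\quad \mathbf{C}=C_2M^\top+D_2\hat CX,\quad \mathbf{B}=NB_2+Y\hat BD_2,$$ $$\mathbf{A}=Y\mathcal{A}_1X+Y\mathcal{A}_2M^\top+N\mathcal{A}_3X+N\mathcal{A}_4M^\top.$$ Also $$\Pi_1=\begin{bmatrix}X&I\\ M^\top&\mathbf{0}\end{bmatrix},\qquad \Pi_2=\begin{bmatrix}I&Y\\ \mathbf{0}&N^\top\end{bmatrix}.$$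 Forward invariance under $a^\top R_aa\le1$. A set $\Omega$ is forward invariant if, for every initial condition $\zeta(0)\in\Omega$ and every (measurable) attack signal $a:[0,\infty)\to\mathbb{R}^{n_u+n_y}$ with $a(t)^\top R_aa(t)\le1$ for all $t\ge0$, the solution satisfies $\zeta(t)\in\Omega$ for all $t\ge0$. $\mathcal{E}_P=\{\zeta:\zeta^\top P\zeta\le1\}$. $M\succ0$ ($M\succeq0$, $M\preceq 0$) means symmetric positive definite (positive semidefinite, negative semidefinite). ''Solve'' means being a minimizer of the optimization problem. *)

(* Defs.v *)
From mathcomp Require Export all_boot all_order all_algebra.
From mathcomp Require Export all_classical all_reals all_analysis.

Set Implicit Arguments.
Unset Strict Implicit.
Unset Printing Implicit Defensive.

Export Order.TTheory GRing.Theory Num.Theory.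
Export numFieldNormedType.Exports.

Local Open Scope classical_set_scope.
Local Open Scope ring_scope.

Definition quad (R : realType) (n : nat) (S : 'M[R]_n) (x : 'cV[R]_n) : R :=
  (x^T *m S *m x) 0 0.

Definition posdefmx (R : realType) (n : nat) (S : 'M[R]_n) : Prop :=
  S^T = S /\ forall x : 'cV[R]_n, x != 0 -> 0 < quad S x.

Definition possemidefmx (R : realType) (n : nat) (S : 'M[R]_n) : Prop :=
  S^T = S /\ forall x : 'cV[R]_n, 0 <= quad S x.

Definition negsemidefmx (R : realType) (n : nat) (S : 'M[R]_n) : Prop :=
  S^T = S /\ forall x : 'cV[R]_n, quad S x <= 0.

Definition ellipsoid (R : realType) (n : nat) (S : 'M[R]_n) (c : 'cV[R]_n) :
    set 'cV[R]_n :=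
  [set x | quad S (x - c) <= 1].

Definition centered_ellipsoid (R : realType) (n : nat) (S : 'M[R]_n) :
    set 'cV[R]_n :=
  [set x | quad S x <= 1].

Definition proj_fst (R : realType) (n1 n2 : nat) (E : set 'cV[R]_(n1 + n2)) :
    set 'cV[R]_n1 :=
  usubmx @` E.

(** Dimensions: [np] plant state, [nc] primary controller state, [nu] plant
    input, [ny] plant output, [mu] secondary output [u_S], [my] secondary
    input [y_S]. *)
Record primary_loop (R : realType) (np nc nu ny mu my : nat) := PrimaryLoop {
  Ap : 'M[R]_np;        Bp : 'M[R]_(np, nu);  Cp : 'M[R]_(ny, np);
  A1 : 'M[R]_nc;        B1 : 'M[R]_(nc, ny);
  C1 : 'M[R]_(nu, nc);  D1 : 'M[R]_(nu, ny);
  Eu : 'M[R]_(nu, mu);  CS : 'M[R]_(my, ny)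
}.

Record secondary (R : realType) (n2 mu my : nat) := Secondary {
  A2 : 'M[R]_n2;        B2 : 'M[R]_(n2, my);
  C2 : 'M[R]_(mu, n2);  D2 : 'M[R]_(mu, my)
}.

Definition Ahat (R : realType) (np nc nu ny mu my : nat)
    (G : primary_loop R np nc nu ny mu my) : 'M[R]_(np + nc) :=
  block_mx (Ap G + Bp G *m D1 G *m Cp G) (Bp G *m C1 G)
           (B1 G *m Cp G)                (A1 G).

Definition Bhat (R : realType) (np nc nu ny mu my : nat)
    (G : primary_loop R np nc nu ny mu my) : 'M[R]_(np + nc, mu) :=
  col_mx (Bp G *m Eu G) 0.

Definition Chat (R : realType) (np nc nu ny mu my : nat)
    (G : primary_loop R np nc nu ny mu my) : 'M[R]_(my, np + nc) :=
  row_mx (CS G *m Cp G) 0.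

(** The columns follow the ordering [a = col_mx a_u a_y] of the attack. *)
Definition calB1 (R : realType) (np nc nu ny mu my : nat)
    (G : primary_loop R np nc nu ny mu my) : 'M[R]_(np + nc, nu + ny) :=
  block_mx (Bp G) (Bp G *m D1 G)
           0      (B1 G).

Definition calA11 (R : realType) (np nc nu ny mu my n2 : nat)
    (G : primary_loop R np nc nu ny mu my) (K : secondary R n2 mu my) :
    'M[R]_(np + nc) :=
  Ahat G + Bhat G *m D2 K *m Chat G.

Definition calA12 (R : realType) (np nc nu ny mu my n2 : nat)
    (G : primary_loop R np nc nu ny mu my) (K : secondary R n2 mu my) :
    'M[R]_(np + nc, n2) :=
  Bhat G *m C2 K.

Definition calA21 (R : realType) (np nc nu ny mu my n2 : nat)
    (G : primary_loop R np nc nu ny mu my) (K : secondary R n2 mu my) :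
    'M[R]_(n2, np + nc) :=
  B2 K *m Chat G.

Definition calA22 (R : realType) (n2 mu my : nat) (K : secondary R n2 mu my) :
    'M[R]_n2 :=
  A2 K.

Definition calA (R : realType) (np nc nu ny mu my n2 : nat)
    (G : primary_loop R np nc nu ny mu my) (K : secondary R n2 mu my) :
    'M[R]_((np + nc) + n2) :=
  block_mx (calA11 G K) (calA12 G K)
           (calA21 G K) (calA22 K).

Definition calB (R : realType) (np nc nu ny mu my : nat) (n2 : nat)
    (G : primary_loop R np nc nu ny mu my) :
    'M[R]_((np + nc) + n2, nu + ny) :=
  col_mx (calB1 G) 0.

(** The real line with the sigma-algebra of Lebesgue (not merely Borel)
    measurable sets, on which [completed_lebesgue_measure] lives. *)
Notation lebesgueR R := (caratheodory_type
  ((wlength (idfun : R -> R))^*)%mu).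

Definition lebesgue_measurable_fun (R : realType) (D : set R) (f : R -> R) :
    Prop :=
  @measurable_fun _ _ (lebesgueR R) (measurableTypeR R) D f.

(** Caratheodory solution of [z' = A z + B a] on [[0, +oo[], in integral form;
    the values of [a] and [z] at negative times are irrelevant. *)
Definition trajectory (R : realType) (n m : nat) (A : 'M[R]_n)
    (B : 'M[R]_(n, m)) (a : R -> 'cV[R]_m) (z : R -> 'cV[R]_n) : Prop :=
  {within `[0, +oo[, continuous z} /\
  forall (t : R) (i : 'I_n), 0 <= t ->
    let f (s : R) : R := (A *m z s + B *m a s) i 0 in
    completed_lebesgue_measure.-integrable `[0, t] (EFin \o f) /\
    z t i 0 = z 0 i 0 + \int[completed_lebesgue_measure]_(s in `[0, t]) f s.

Definition admissible_attack (R : realType) (m : nat) (Ra : 'M[R]_m)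
    (a : R -> 'cV[R]_m) : Prop :=
  (forall j : 'I_m,
     lebesgue_measurable_fun `[0, +oo[ (fun t : R => a t j 0)) /\
  forall t : R, 0 <= t -> quad Ra (a t) <= 1.

Definition forward_invariant (R : realType) (n m : nat) (A : 'M[R]_n)
    (B : 'M[R]_(n, m)) (Ra : 'M[R]_m) (Omega : set 'cV[R]_n) : Prop :=
  forall (a : R -> 'cV[R]_m) (z : R -> 'cV[R]_n),
    admissible_attack Ra a -> trajectory A B a z -> Omega (z 0) ->
    forall t : R, 0 <= t -> Omega (z t).

(** [X] and [Y] are not constrained to be symmetric here; [feasible] imposes it. *)
Record lmi_var (R : realType) (n mu my : nat) := LmiVar {
  X : 'M[R]_n;          Y : 'M[R]_n;
  bfA : 'M[R]_n;        bfB : 'M[R]_(n, my);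
  bfC : 'M[R]_(mu, n);  bfD : 'M[R]_(mu, my)
}.

Definition block3_mx (R : realType) (m1 m2 m3 : nat)
    (M11 : 'M[R]_m1)       (M12 : 'M[R]_(m1, m2)) (M13 : 'M[R]_(m1, m3))
    (M21 : 'M[R]_(m2, m1)) (M22 : 'M[R]_m2)       (M23 : 'M[R]_(m2, m3))
    (M31 : 'M[R]_(m3, m1)) (M32 : 'M[R]_(m3, m2)) (M33 : 'M[R]_m3) :
    'M[R]_(m1 + m2 + m3) :=
  block_mx (block_mx M11 M12 M21 M22) (col_mx M13 M23)
           (row_mx M31 M32)           M33.

Definition Peta (R : realType) (n mu my : nat) (eta : lmi_var R n mu my) :
    'M[R]_(n + n) :=
  block_mx (X eta) 1%:M
           1%:M    (Y eta).

Definition Aeta (R : realType) (np nc nu ny mu my : nat)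
    (G : primary_loop R np nc nu ny mu my)
    (eta : lmi_var R (np + nc) mu my) : 'M[R]_((np + nc) + (np + nc)) :=
  block_mx
    (Ahat G *m X eta + Bhat G *m bfC eta) (Ahat G + Bhat G *m bfD eta *m Chat G)
    (bfA eta)                             (Y eta *m Ahat G + bfB eta *m Chat G).

Definition Beta (R : realType) (np nc nu ny mu my : nat)
    (G : primary_loop R np nc nu ny mu my)
    (eta : lmi_var R (np + nc) mu my) :
    'M[R]_((np + nc) + (np + nc), nu + ny) :=
  col_mx (calB1 G) (Y eta *m calB1 G).

Definition bfE2 (R : realType) (np nc nu ny mu my : nat)
    (G : primary_loop R np nc nu ny mu my)
    (eta : lmi_var R (np + nc) mu my) :
    'M[R]_((np + nc) + (np + nc) + 1 + (nu + ny)) :=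
  block3_mx ((Aeta G eta)^T + Aeta G eta) 0 (Beta G eta)
            0                             0 0
            (Beta G eta)^T                0 0.

(** The explicit [k] is the size of the last (zero) block. *)
Definition bfF (R : realType) (n mu my k : nat) (eta : lmi_var R n mu my) :
    'M[R]_(n + n + 1 + k) :=
  block3_mx (Peta eta) 0        0
            0          (- 1%:M) 0
            0          0        0.

Definition bfS (R : realType) (n k : nat) (Ra : 'M[R]_k) :
    'M[R]_(n + n + 1 + k) :=
  block3_mx 0 0    0
            0 1%:M 0
            0 0    (- Ra).

Definition bfJ (R : realType) (n mu my : nat) (Rh : 'M[R]_n) (c : 'cV[R]_n)
    (eta : lmi_var R n mu my) : 'M[R]_(n + 1 + n) :=
  block3_mx
    0                         (- (X eta *m Rh *m c))    (- X eta)
    (- (c^T *m Rh *m X eta))  (c^T *m Rh *m c - 1%:M)   0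
    (- X eta)                 0                         (- invmx Rh).

Definition bfL (R : realType) (n mu my : nat) (eta : lmi_var R n mu my) :
    'M[R]_(n + 1 + n) :=
  block3_mx (X eta) 0        0
            0       (- 1%:M) 0
            0       0        0.

Definition feasible (R : realType) (np nc nu ny mu my : nat)
    (G : primary_loop R np nc nu ny mu my)
    (Rh : 'M[R]_(np + nc)) (c : 'cV[R]_(np + nc))
    (eta : lmi_var R (np + nc) mu my) (Ra : 'M[R]_(nu + ny))
    (alpha beta delta : R) : Prop :=
  [/\ (X eta)^T = X eta /\ (Y eta)^T = Y eta, posdefmx Ra &
      [/\ 0 <= alpha, 0 <= beta & 0 <= delta]] /\
  [/\ negsemidefmx (bfE2 G eta + alpha *: bfF (nu + ny) eta
                      + beta *: bfS (np + nc) Ra),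
      posdefmx (Peta eta) &
      negsemidefmx (bfJ Rh c eta - delta *: bfL eta)].

Definition optimal (R : realType) (np nc nu ny mu my : nat)
    (G : primary_loop R np nc nu ny mu my)
    (Rh : 'M[R]_(np + nc)) (c : 'cV[R]_(np + nc))
    (eta : lmi_var R (np + nc) mu my) (Ra : 'M[R]_(nu + ny))
    (alpha beta delta : R) : Prop :=
  feasible G Rh c eta Ra alpha beta delta /\
  forall (eta' : lmi_var R (np + nc) mu my) (Ra' : 'M[R]_(nu + ny))
         (alpha' beta' delta' : R),
    feasible G Rh c eta' Ra' alpha' beta' delta' -> \tr Ra <= \tr Ra'.

Definition change_of_variables (R : realType) (np nc nu ny mu my : nat)
    (G : primary_loop R np nc nu ny mu my)
    (eta : lmi_var R (np + nc) mu my) (M N : 'M[R]_(np + nc))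
    (K : secondary R (np + nc) mu my) : Prop :=
  [/\ bfD eta = D2 K,
      bfC eta = C2 K *m M^T + D2 K *m Chat G *m X eta,
      bfB eta = N *m B2 K + Y eta *m Bhat G *m D2 K &
      bfA eta = Y eta *m calA11 G K *m X eta + Y eta *m calA12 G K *m M^T
                + N *m calA21 G K *m X eta + N *m calA22 K *m M^T].

Definition Pi1 (R : realType) (n mu my : nat) (eta : lmi_var R n mu my)
    (M : 'M[R]_n) : 'M[R]_(n + n) :=
  block_mx (X eta) 1%:M
           M^T     0.

Definition Pi2 (R : realType) (n mu my : nat) (eta : lmi_var R n mu my)
    (N : 'M[R]_n) : 'M[R]_(n + n) :=
  block_mx 1%:M (Y eta)
           0    N^T.

(* Main.v *)
Require Import Defs.
From mathcomp Require Import ring lra.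

(** By the change of variables, congruence with [Pi1] turns [P] into [P(eta)],
    [P calA] into [A(eta)] and [P calB] into [B(eta)]. So [P] is positive definite,
    and the first matrix inequality says (S-procedure) that [zeta^T P zeta] does not
    increase along the flow at any point where it is at least 1, whatever the
    admissible attack; this yields invariance. The first columns of
    [P Pi1 = Pi2] show that the projection of [E_P] is contained in
    [{X v | v^T X v <= 1}], and the inequality on [J - delta L] places this set
    inside the projected safe set. *)

Set Implicit Arguments.
Unset Strict Implicit.
Unset Printing Implicit Defensive.

Local Open Scope classical_set_scope.
Local Open Scope ring_scope.

(** * Quadratic forms and the matrix inequalities *)

Definition dotc (R : realType) (n : nat) (u v : 'cV[R]_n) : R := (u^T *m v) 0 0.

Lemma dotcE (R : realType) (n : nat) (u v : 'cV[R]_n) :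
  dotc u v = \sum_i u i 0 * v i 0.
Proof. by rewrite /dotc mxE; apply: eq_bigr => i _; rewrite mxE. Qed.

Lemma dotcC (R : realType) (n : nat) (u v : 'cV[R]_n) : dotc u v = dotc v u.
Proof. by rewrite !dotcE; apply: eq_bigr => i _; rewrite mulrC. Qed.

Lemma dotcDr (R : realType) (n : nat) (u v w : 'cV[R]_n) :
  dotc u (v + w) = dotc u v + dotc u w.
Proof. by rewrite /dotc mulmxDr mxE. Qed.

Lemma dotcDl (R : realType) (n : nat) (u v w : 'cV[R]_n) :
  dotc (u + v) w = dotc u w + dotc v w.
Proof. by rewrite !(dotcC _ w) dotcDr. Qed.

Lemma dotcNr (R : realType) (n : nat) (u v : 'cV[R]_n) :
  dotc u (- v) = - dotc u v.
Proof. by rewrite /dotc mulmxN mxE. Qed.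

Lemma dotcNl (R : realType) (n : nat) (u v : 'cV[R]_n) :
  dotc (- u) v = - dotc u v.
Proof. by rewrite !(dotcC _ v) dotcNr. Qed.

Lemma dotc0r (R : realType) (n : nat) (u : 'cV[R]_n) : dotc u 0 = 0.
Proof. by rewrite /dotc mulmx0 mxE. Qed.

Lemma dotc_mulmx (R : realType) (m n : nat) (S : 'M[R]_(m, n)) u v :
  dotc u (S *m v) = dotc (S^T *m u) v.
Proof. by rewrite /dotc trmx_mul trmxK mulmxA. Qed.

Lemma dotc_col_mx (R : realType) (m n : nat) (u1 v1 : 'cV[R]_m)
    (u2 v2 : 'cV[R]_n) :
  dotc (col_mx u1 u2) (col_mx v1 v2) = dotc u1 v1 + dotc u2 v2.
Proof. by rewrite /dotc tr_col_mx mul_row_col mxE. Qed.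

Lemma quadE (R : realType) (n : nat) (S : 'M[R]_n) x : quad S x = dotc x (S *m x).
Proof. by rewrite /quad /dotc mulmxA. Qed.

Lemma dotc_tr (R : realType) (m n : nat) (S : 'M[R]_(m, n)) u v :
  dotc u (S^T *m v) = dotc v (S *m u).
Proof. by rewrite dotc_mulmx trmxK dotcC. Qed.

Lemma quad_tr (R : realType) (n : nat) (S : 'M[R]_n) x :
  quad S^T x = quad S x.
Proof. by rewrite !quadE dotc_tr. Qed.

Lemma quadD (R : realType) (n : nat) (S T : 'M[R]_n) x :
  quad (S + T) x = quad S x + quad T x.
Proof. by rewrite !quadE mulmxDl dotcDr. Qed.

Lemma quadZ (R : realType) (n : nat) (a : R) (S : 'M[R]_n) x :
  quad (a *: S) x = a * quad S x.
Proof. by rewrite /quad -scalemxAr -scalemxAl mxE. Qed.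

Lemma quadB_sym (R : realType) (n : nat) (S : 'M[R]_n) x y : S^T = S ->
  quad S (x - y) = quad S x - 2 * dotc x (S *m y) + quad S y.
Proof.
move=> hS; rewrite !quadE mulmxBr !(dotcDr, dotcDl, dotcNr, dotcNl).
rewrite (_ : dotc y (S *m x) = dotc x (S *m y)); first by ring.
by rewrite dotc_mulmx hS dotcC.
Qed.

Lemma posdef_unitmx (R : realType) (n : nat) (S : 'M[R]_n) :
  posdefmx S -> S \in unitmx.
Proof.
move=> [hS hpos]; rewrite -row_free_unit -kermx_eq0; apply/rowV0P => v.
move/sub_kermxP => hv; apply/eqP/negPn/negP => v0.
have := hpos v^T; rewrite /quad trmxK hv mul0mx mxE ltxx.
suff -> : v^T != 0 by move=> /(_ isT).
by rewrite -trmx0 (inj_eq trmx_inj).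
Qed.

Lemma posdef_ge0 (R : realType) (n : nat) (S : 'M[R]_n) x :
  posdefmx S -> 0 <= quad S x.
Proof.
move=> [_ hpos]; have [->|/hpos/ltW//] := eqVneq x 0.
by rewrite quadE mulmx0 dotc0r.
Qed.

Lemma posdef_congr (R : realType) (n : nat) (S T : 'M[R]_n) :
  posdefmx (T^T *m S *m T) -> T \in unitmx -> posdefmx S.
Proof.
move=> [hsym hpos] hT; split.
  have := hsym; rewrite !trmx_mul trmxK mulmxA.
  have hTT : T^T \in unitmx by rewrite unitmx_tr.
  by move/(congr1 (fun W => invmx T^T *m W *m invmx T));
     rewrite -!mulmxA mulmxV // !mulmx1 !mulKmx.
move=> x x0.
have <- : quad (T^T *m S *m T) (invmx T *m x) = quad S x.
  by rewrite quadE -!mulmxA mulKVmx// dotc_mulmx trmxK mulKVmx// quadE.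
apply: hpos; apply: contraNneq x0 => /(congr1 (mulmx T)).
by rewrite mulKVmx// mulmx0 => ->.
Qed.

(** Fixing the middle entry at 1 homogenizes: a block inequality becomes an inhomogeneous quadratic
    inequality in [v] and [w]. *)
Lemma quad_block3 (R : realType) (m1 m3 : nat)
    (M11 : 'M[R]_m1) (M12 : 'M[R]_(m1, 1)) (M13 : 'M[R]_(m1, m3))
    (M21 : 'M[R]_(1, m1)) (M22 : 'M[R]_1) (M23 : 'M[R]_(1, m3))
    (M31 : 'M[R]_(m3, m1)) (M32 : 'M[R]_(m3, 1)) (M33 : 'M[R]_m3) v w :
  quad (block3_mx M11 M12 M13 M21 M22 M23 M31 M32 M33)
    (col_mx (col_mx v 1%:M) w)
  = dotc v (M11 *m v + M12 + M13 *m w) + (M21 *m v + M22 + M23 *m w) 0 0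
    + dotc w (M31 *m v + M32 + M33 *m w).
Proof.
rewrite quadE /block3_mx mul_block_col mul_row_col mul_block_col mul_col_mx.
rewrite add_col_mx !mulmx1 !dotc_col_mx; congr (_ + _ + _).
by rewrite /dotc trmx1 mul1mx.
Qed.

(** * Congruence by [Pi1] and consequences of the matrix inequalities *)

Lemma Pi1_unitmx (R : realType) (n mu my : nat) (eta : lmi_var R n mu my)
    (M : 'M[R]_n) :
  M \in unitmx -> Pi1 eta M \in unitmx.
Proof.
move=> hM; have hMT : M^T \in unitmx by rewrite unitmx_tr.
suff /mulmx1_unit[] : Pi1 eta M *m
  block_mx 0 (invmx M^T) 1%:M (- (X eta *m invmx M^T)) = 1%:M by [].
rewrite /Pi1 mulmx_block !(mulmx0, mul0mx, mulmx1, mul1mx, add0r, addr0).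
by rewrite subrr mulmxV// -scalar_mx_block.
Qed.

(** The upper right block of the product is [X Y + M N^T], which the factorization of [I - X Y]
    makes the identity. *)
Lemma Pi1_Pi2 (R : realType) (n mu my : nat) (eta : lmi_var R n mu my)
    (M N : 'M[R]_n) :
  (X eta)^T = X eta -> M *m N^T = 1%:M - X eta *m Y eta ->
  (Pi1 eta M)^T *m Pi2 eta N = Peta eta.
Proof.
move=> hX hMN; rewrite /Pi1 /Pi2 tr_block_mx mulmx_block trmxK trmx0 trmx1 hX.
rewrite !(mulmx0, mul0mx, mulmx1, mul1mx, add0r, addr0) hMN.
by rewrite addrC subrK.
Qed.

(** Expanding the product gives bilinear terms in the controller and in [X], [Y], [M], [N]; the
    change of variables names exactly these combinations, so each block becomes affine in [eta]. *)
Lemma Aeta_congr (R : realType) (np nc nu ny mu my : nat)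
    (G : primary_loop R np nc nu ny mu my) (eta : lmi_var R (np + nc) mu my)
    (M N : 'M[R]_(np + nc)) (K : secondary R (np + nc) mu my) :
  (Y eta)^T = Y eta -> change_of_variables G eta M N K ->
  (Pi2 eta N)^T *m calA G K *m Pi1 eta M = Aeta G eta.
Proof.
move=> hY [hD hC hB hA].
rewrite /Pi1 /Pi2 /calA /Aeta tr_block_mx trmxK trmx0 trmx1 hY hA hB hC hD.
rewrite !mulmx_block !(mulmx0, mul0mx, mulmx1, mul1mx, add0r, addr0).
congr block_mx.
- rewrite /calA11 /calA12 !(mulmxDl, mulmxDr) !mulmxA -!addrA.
  by congr (_ + _); rewrite addrC.
- by rewrite !mulmxDl addrACA addrA.
- rewrite /calA11 /calA21 !(mulmxDl, mulmxDr) !mulmxA -!addrA.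
  by congr (_ + _); rewrite addrC.
Qed.

Lemma Beta_congr (R : realType) (np nc nu ny mu my : nat)
    (G : primary_loop R np nc nu ny mu my) (eta : lmi_var R (np + nc) mu my)
    (N : 'M[R]_(np + nc)) :
  (Y eta)^T = Y eta ->
  (Pi2 eta N)^T *m calB (np + nc) G = Beta G eta.
Proof.
move=> hY; rewrite /Pi2 /calB /Beta tr_block_mx trmxK trmx0 trmx1 hY mul_block_col.
by rewrite !(mulmx0, mul0mx, mul1mx, addr0).
Qed.

(** S-procedure: on [(x, 1, a)] the inequality reads [2 x^T (A x + B a) + alpha (x^T P x - 1) + beta
    (1 - a^T Ra a) <= 0], with [A], [B], [P] taken at [eta], and both multiplier terms are
    nonnegative here. *)
Lemma lmi_decrease (R : realType) (np nc nu ny mu my : nat)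
  (G : primary_loop R np nc nu ny mu my)
  (eta : lmi_var R (np + nc) mu my) (Ra : 'M[R]_(nu + ny)) (alpha beta : R) :
  0 <= alpha -> 0 <= beta ->
  negsemidefmx (bfE2 G eta + alpha *: bfF (nu + ny) eta
                      + beta *: bfS (np + nc) Ra) ->
  forall x a, 1 <= quad (Peta eta) x -> quad Ra a <= 1 ->
  dotc x (Aeta G eta *m x + Beta G eta *m a) <= 0.
Proof.
move=> al0 be0 [_ h] x a hx ha.
have := h (col_mx (col_mx x 1%:M) a).
rewrite 2!quadD !quadZ !quad_block3 !(mul0mx, addr0, add0r).
rewrite mulmxDl !dotcDr !dotc0r !mxE /= mulNmx dotcNr -!quadE quad_tr dotc_tr => H.
have := mulr_ge0 al0 (_ : 0 <= quad (Peta eta) x - 1).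
have := mulr_ge0 be0 (_ : 0 <= 1 - quad Ra a).
by rewrite !subr_ge0 => /(_ ha) h1 /(_ hx) h2; lra.
Qed.

(* Test the inequality on [(v, 1, - Rh X v)], whose last block maximizes the form. *)
Lemma lmi_projection (R : realType) (n mu my : nat) (eta : lmi_var R n mu my)
  (Rh : 'M[R]_n) (c : 'cV[R]_n) (delta : R) :
  posdefmx Rh -> (X eta)^T = X eta -> 0 <= delta ->
  negsemidefmx (bfJ Rh c eta - delta *: bfL eta) ->
  forall v, quad (X eta) v <= 1 -> quad Rh (X eta *m v - c) <= 1.
Proof.
move=> hRh hX de0 [_ h] v hv; set x := X eta *m v.
have [hRs _] := hRh; have hRu := posdef_unitmx hRh.
have := h (col_mx (col_mx v 1%:M) (- (Rh *m x))).
rewrite quadD -scaleNr quadZ !quad_block3 !(mul0mx, addr0, add0r).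
rewrite !(mulNmx, mulmxN) opprK mulKmx // -/x.
rewrite !(dotcDr, dotcNr, dotcNl, dotc0r) -!mulmxA -/x.
have hxv w : dotc v (X eta *m w) = dotc x w by rewrite dotc_mulmx hX.
rewrite quadB_sym // !hxv.
have -> : (- (c^T *m (Rh *m x)) + (c^T *m (Rh *m c) - 1%:M)) 0 0
    = - dotc x (Rh *m c) + (quad Rh c - 1).
  rewrite -[in dotc x _]hRs dotc_tr quadE mxE [(- (c^T *m (Rh *m x))) 0 0]mxE.
  by rewrite [(_ - 1%:M) 0 0]mxE /dotc !(mxE, mulr1n).
rewrite (_ : (- 1%:M) 0 0 = -1 :> R); last by rewrite !mxE.
rewrite (_ : dotc x v = quad (X eta) v); last by rewrite quadE dotcC.
rewrite (dotcC (Rh *m x)) -quadE => H.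
(* Up to expansion, [H] says [quad Rh (x - c) - 1 + delta * (1 - quad (X eta) v) <= 0]. *)
have := mulr_ge0 de0 (_ : 0 <= 1 - quad (X eta) v).
by rewrite subr_ge0 => /(_ hv) h1; lra.
Qed.

(* [S *m v] minimizes [quad P] on the fibre [T *m z = X *m v]. *)
Lemma posdef_slice (R : realType) (n m : nat) (P : 'M[R]_n)
    (T : 'M[R]_(m, n)) (S : 'M[R]_(n, m)) (X : 'M[R]_m) :
  posdefmx P -> P *m S = T^T -> T *m S = X ->
  forall z v, T *m z = X *m v -> quad X v <= quad P z.
Proof.
move=> hP hPS hTS z v hz; have := posdef_ge0 (z - S *m v) hP.
have [hPs _] := hP; rewrite quadB_sym //.
have -> : dotc z (P *m (S *m v)) = quad X v.
  by rewrite (mulmxA P) hPS dotc_tr hz quadE.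
have -> : quad P (S *m v) = quad X v.
  by rewrite quadE (mulmxA P) hPS dotc_tr (mulmxA T) hTS -quadE.
by lra.
Qed.

Lemma Peta_posdef_X (R : realType) (n mu my : nat) (eta : lmi_var R n mu my) :
  (X eta)^T = X eta -> posdefmx (Peta eta) -> posdefmx (X eta).
Proof.
move=> hX [_ hpos]; split=> // x x0; have := hpos (col_mx x 0).
rewrite !quadE mul_block_col dotc_col_mx !mulmx0 !addr0 (dotcC 0) dotc0r addr0.
by apply; rewrite col_mx_eq0 negb_and x0.
Qed.

Lemma proj_fst_decomp (R : realType) (n mu my : nat) (eta : lmi_var R n mu my)
    (M N : 'M[R]_n) (P : 'M[R]_(n + n)) z :
  posdefmx P -> posdefmx (X eta) -> P *m Pi1 eta M = Pi2 eta N ->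
  exists2 v, usubmx z = X eta *m v & quad (X eta) v <= quad P z.
Proof.
move=> hP hX hPi; have hXu := posdef_unitmx hX.
exists (invmx (X eta) *m usubmx z); first by rewrite mulKVmx.
(* [T] is the projection onto the first coordinates and [S] the first block column of [Pi1];
   [P S = T^T] is then the first block column of [P Pi1 = Pi2]. *)
apply: (@posdef_slice _ _ _ P (row_mx 1%:M 0) (col_mx (X eta) M^T)) => //.
- have := congr1 lsubmx hPi; rewrite /Pi1 /Pi2.
  rewrite -[LHS](_ : P *m lsubmx (Pi1 eta M) = _); last first.
    by rewrite [LHS]mulmx_lsub.
  by rewrite /Pi1 !block_mxEh !row_mxKl tr_row_mx trmx1 trmx0.
- by rewrite mul_row_col mul1mx mul0mx addr0.
- by rewrite -[z in LHS]vsubmxK mul_row_col mul1mx mul0mx addr0 mulKVmx.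
Qed.

(** * Integral inequalities along trajectories *)

Lemma measurable_itv_lebesgueR (R : realType) (i : interval R) :
  measurable ([set` i] : set (lebesgueR R)).
Proof. apply: sub_caratheodory; exact: measurable_itv. Qed.

Lemma completed_lebesgue_measure_oc (R : realType) (s t : R) : s <= t ->
  completed_lebesgue_measure `]s, t]%classic = (t - s)%:E.
Proof.
move=> st; have := lebesgue_measure_itv `]s, t]; rewrite /= lte_fin => h.
rewrite -[LHS]/(lebesgue_measure (`]s, t]%classic : set R)) h.
by case: ltP => // ts; rewrite (_ : t = s) ?subrr//; apply/eqP; rewrite eq_le ts st.
Qed.

Lemma within_continuous_comp (R : realType) (T U : topologicalType)
  (f : R -> T) (g : T -> U) (A B : set R) :
  B `<=` A -> {within A, continuous f} -> continuous g ->
  {within B, continuous (g \o f)}.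
Proof.
move=> BA cf cg.
apply: (continuous_subspaceW BA).
by move=> x; apply: (@continuous_comp (subspace A) T U f g x); [exact: cf|exact: cg].
Qed.

Lemma within_continuous_bounded (R : realType) (f : R -> R) (T : R) : 0 <= T ->
  {within `[0, T], continuous f} ->
  exists c, forall t, t \in `[0, T] -> `|f t| <= c.
Proof.
move=> T0 cf.
have cn : {within `[0, T], continuous (fun x => `|f x|)}.
  apply: (@within_continuous_comp _ _ _ f Num.norm _ _ (@subset_refl _ _) cf).
  exact: norm_continuous.
have [||c _ hc] := compact_EVT_max _ _ cn.
- by exists 0; rewrite /= in_itv /= lexx.
- exact: segment_compact.
by exists (`|f c|) => t ht; apply: hc; rewrite inE.
Qed.

(** Cut [[a, b]] into [n + 1] equal pieces: the increments add up to at most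
    [K (b - a)^2 / (n + 1)], which tends to 0. *)
Lemma le_of_quadratic_increment (R : realType) (g : R -> R) (a b K : R) :
  a <= b ->
  (forall s t, a <= s -> s <= t -> t <= b -> g t - g s <= K * (t - s) ^+ 2) ->
  g b <= g a.
Proof.
move=> ab H.
have step n k : (k <= n.+1)%N ->
    g (a + k%:R * ((b - a) / n.+1%:R)) - g a
      <= k%:R * (K * ((b - a) / n.+1%:R) ^+ 2).
  have h0 : 0 <= (b - a) / n.+1%:R by rewrite divr_ge0 ?subr_ge0.
  have hb j : (j <= n.+1)%N -> a + j%:R * ((b - a) / n.+1%:R) <= b.
    move=> jn; rewrite -lerBrDl mulrA ler_pdivrMr ?ltr0n// mulrC.
    by rewrite ler_wpM2l ?subr_ge0// ler_nat.
  move: h0 hb; set h := _ / _ => h0 hb.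
  elim: k => [_|k IH kn]; first by rewrite !mul0r addr0 subrr.
  have := H (a + k%:R * h) (a + k.+1%:R * h) _ _ (hb _ kn).
  rewrite lerDl mulr_ge0 // lerD2l ler_wpM2r // ?ler_nat //= => /(_ isT isT).
  have := IH (ltnW kn).
  have -> : a + k.+1%:R * h - (a + k%:R * h) = h.
    by rewrite -natr1; ring.
  by rewrite -[k.+1%:R]natr1 mulrDl mul1r; lra.
rewrite leNgt; apply/negP => ltab.
set e := g b - g a; have e0 : 0 < e by rewrite subr_gt0.
(* Once [n + 1] exceeds [C], the total bound is strictly below the supposed increase [e]. *)
set C := `|K| * (b - a) ^+ 2 / e.
have := truncnS_gt C; set n := Num.trunc C => Cn1.
have := step n n.+1 (leqnn _).
have n0 : n.+1%:R != 0 :> R by rewrite pnatr_eq0.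
rewrite mulrCA divff // mulr1 [a + _]addrC subrK -/e.
have -> : n.+1%:R * (K * ((b - a) / n.+1%:R) ^+ 2) = K * (b - a) ^+ 2 / n.+1%:R.
  by field.
rewrite ler_pdivlMr ?ltr0n// leNgt => /negP; apply.
move: Cn1; rewrite /C ltr_pdivrMr // mulrC [e * _]mulrC; apply: le_lt_trans.
by rewrite mulrC ler_wpM2r ?exprn_ge0 ?subr_ge0// ler_norm.
Qed.

(** [t0] is the supremum of the times in [[0, T]] at which [g <= c]. The one-sided growth bound,
    applied from such times just before [t0], replaces continuity in showing [g t0 <= c]. *)
Lemma last_exit_time (R : realType) (g : R -> R) (c T L : R) :
  0 <= T -> g 0 <= c ->
  (forall s t, 0 <= s -> s <= t -> t <= T -> g t - g s <= L * (t - s)) ->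
  exists t0, [/\ 0 <= t0, t0 <= T, g t0 <= c &
                 forall r, t0 < r -> r <= T -> c < g r].
Proof.
move=> T0 g0 H.
pose S := [set s : R | [/\ 0 <= s, s <= T & g s <= c]].
have S0 : S 0 by [].
have ubS : has_ubound S by exists T => s [].
have supS : has_sup S by split => //; exists 0.
have le0 : 0 <= sup S by apply: ub_le_sup.
have leT : sup S <= T by apply: ge_sup; [exists 0 | move=> s []].
exists (sup S); split => //; last first.
  move=> r Sr rT; rewrite ltNge; apply/negP => gr.
  have : r <= sup S by apply: ub_le_sup => //; split => //; exact: le_trans (ltW Sr).
  by rewrite leNgt Sr.
apply/ler_addgt0Pr => e e0.
(* The added 1 keeps the denominator positive even if [L] is 0. *)
have d0 : 0 < e / (1 + `|L|) by rewrite divr_gt0// ltr_wpDr.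
have [s Ss ls] := sup_adherent d0 supS.
have sle : s <= sup S by apply: ub_le_sup.
case: Ss => s0 sT gs; have := H s (sup S) s0 sle leT.
suff : L * (sup S - s) <= e by lra.
apply: (@le_trans _ _ ((1 + `|L|) * (e / (1 + `|L|)))); last first.
  by rewrite mulrC divfK// gt_eqF// ltr_wpDr.
have := ler_norm L; have := normr_ge0 L; nra.
Qed.

Lemma Rintegral_sum d (T : measurableType d) (R : realType)
    (mu : {measure set T -> \bar R}) (D : set T) (I : Type) (s : seq I)
    (f : I -> T -> R) :
  measurable D -> (forall i, mu.-integrable D (EFin \o f i)) ->
  \int[mu]_(x in D) (\sum_(i <- s) f i x) = \sum_(i <- s) \int[mu]_(x in D) f i x.
Proof.
move=> mD intf; elim: s => [|i s IH].
  rewrite big_nil; under eq_Rintegral do rewrite big_nil.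
  by rewrite Rintegral_cst// mul0r.
rewrite big_cons -IH -RintegralD //.
  by apply: eq_Rintegral => x _; rewrite big_cons.
rewrite (_ : EFin \o _ = fun x => \sum_(j <- s) (EFin \o f j) x)%E.
  exact: integrable_sum.
by apply/funext => x /=; rewrite sumEFin.
Qed.

(** The increment of [z] is the integral of its velocity over []s, t]], so a bound on the velocity
    paired with a fixed [w] integrates. This is how the invariance proof uses the dynamics. *)
Lemma trajectory_increment_le (R : realType) (n m : nat) (A : 'M[R]_n)
    (B : 'M[R]_(n, m)) a z s t (w : 'cV[R]_n) (c : R) :
  trajectory A B a z -> 0 <= s -> s <= t ->
  (forall r, s < r -> r <= t -> dotc w (A *m z r + B *m a r) <= c) ->
  dotc w (z t - z s) <= c * (t - s).
Proof.
move=> [_ H] s0 st hc; have t0 := le_trans s0 st.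
pose f (i : 'I_n) r : R := (A *m z r + B *m a r) i 0.
pose mu := @completed_lebesgue_measure R.
have mst : measurable (`]s, t]%classic : set (lebesgueR R)).
  exact: measurable_itv_lebesgueR.
(* The half-open piece makes the union disjoint, so integrals over [[0, s]] and [[0, t]]
   subtract. *)
have split_st : `[0, t]%classic = (`[0, s] `|` `]s, t])%classic :> set R.
  by rewrite -itv_bndbnd_setU ?bnd_simp.
have intf i : mu.-integrable `]s, t] (EFin \o f i).
  have [+ _] := H t i t0; apply: integrableS => //.
    exact: measurable_itv_lebesgueR.
  by rewrite split_st; right.
have incr i : (z t - z s) i 0 = \int[mu]_(r in `]s, t]) f i r.
  rewrite !mxE; have [it ->] := H t i t0; have [_ ->] := H s i s0.
  rewrite split_st Rintegral_setU //.
  - by rewrite -/mu -/(f i); lra.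
  - exact: measurable_itv_lebesgueR.
  - by rewrite -split_st.
  - apply/disj_setPS => x [] /=; rewrite !in_itv/= => /andP[_ xs] /andP[sx _].
    by move: sx; rewrite ltNge xs.
pose g (i : 'I_n) r : R := w i 0 * f i r.
have intg i : mu.-integrable `]s, t] (EFin \o g i).
  rewrite (_ : _ \o _ = fun r => ((w i 0)%:E * (EFin \o f i) r)%E)//.
  exact: integrableZl.
have -> : dotc w (z t - z s) =
    \int[mu]_(r in `]s, t]) (dotc w (A *m z r + B *m a r)).
  under eq_Rintegral do rewrite dotcE.
  rewrite Rintegral_sum // dotcE; apply: eq_bigr => i _.
  by rewrite incr RintegralZl //; exact: intf.
apply: (@le_trans _ _ (\int[mu]_(r in `]s, t]) c)).
  apply: le_Rintegral => //.
  - rewrite (_ : EFin \o _ =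
        fun r => \sum_(i < n) (EFin \o g i) r)%E.
      exact: integrable_sum.
    by apply/funext => r /=; rewrite sumEFin dotcE.
  - apply/integrableP; split; first exact: measurable_cst.
    rewrite integral_cst //= completed_lebesgue_measure_oc //.
    by rewrite -EFinM ltry.
  - by move=> r /=; rewrite in_itv/= => /andP[sr rt]; exact: hc.
by rewrite Rintegral_cst //= completed_lebesgue_measure_oc.
Qed.

(** * Entrywise bounds on states and attacks, and invariance *)

Definition entries_bounded (R : realType) (n : nat) (S : set R)
    (g : R -> 'cV[R]_n) : Prop :=
  exists C, forall r i, S r -> `|g r i 0| <= C.

Lemma entries_bounded_each (R : realType) (n : nat) (S : set R)
    (g : R -> 'cV[R]_n) :
  (forall i, exists C, forall r, S r -> `|g r i 0| <= C) -> entries_bounded S g.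
Proof.
move=> /choice[C hC]; exists (\sum_i `|C i|) => r i Sr.
rewrite (le_trans (hC i r Sr))// (le_trans (ler_norm _))// (bigD1 i)//=.
by rewrite lerDl sumr_ge0.
Qed.

Lemma entries_boundedD (R : realType) (n : nat) (S : set R)
    (g h : R -> 'cV[R]_n) :
  entries_bounded S g -> entries_bounded S h ->
  entries_bounded S (fun r => g r + h r).
Proof.
move=> [C hC] [D hD]; exists (C + D) => r i Sr; rewrite mxE.
by rewrite (le_trans (ler_normD _ _))// lerD ?hC ?hD.
Qed.

Lemma entries_bounded_mulmx (R : realType) (m n : nat) (S : set R)
    (A : 'M[R]_(m, n)) (g : R -> 'cV[R]_n) :
  entries_bounded S g -> entries_bounded S (fun r => A *m g r).
Proof.
move=> [C hC]; apply: entries_bounded_each => i.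
exists (\sum_j `|A i j| * C) => r Sr; rewrite mxE (le_trans (ler_norm_sum _ _ _))//.
by apply: ler_sum => j _; rewrite normrM ler_wpM2l// hC.
Qed.

(** The times [r] and [s] are independent because the invariance proof pairs states and velocities
    taken at different instants. *)
Lemma entries_bounded_dotc (R : realType) (n : nat) (S : set R)
    (g h : R -> 'cV[R]_n) : entries_bounded S g -> entries_bounded S h ->
  exists K, forall r s, S r -> S s -> `|dotc (g r) (h s)| <= K.
Proof.
move=> [C hC] [D hD]; exists (\sum_(i < n) C * D) => r s Sr Ss.
rewrite dotcE (le_trans (ler_norm_sum _ _ _))//.
by apply: ler_sum => i _; rewrite normrM ler_pM// ?hC ?hD.
Qed.

Lemma continuous_entries_bounded (R : realType) (n : nat) (z : R -> 'cV[R]_n) T :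
  0 <= T -> {within `[0, +oo[, continuous z} ->
  entries_bounded [set r | 0 <= r <= T] z.
Proof.
move=> T0 cz; apply: entries_bounded_each => i.
have [|c hc] := @within_continuous_bounded R (fun r => z r i 0) T T0.
  apply: (@within_continuous_comp _ _ _ z
    (fun M : 'cV[R]_n => M i 0) `[0, +oo[) => //.
    by move=> r /=; rewrite !in_itv/= => /andP[->].
  exact: coord_continuous.
by exists c => r hr; apply: hc; rewrite in_itv.
Qed.

(* Expand [0 <= quad S (y - invmx S *m w)] and [0 <= quad S (y + invmx S *m w)]. *)
Lemma posdef_dotc_bound (R : realType) (n : nat) (S : 'M[R]_n) w y :
  posdefmx S -> 2 * `|dotc w y| <= quad S y + quad S (invmx S *m w).
Proof.
move=> hS; have hu := posdef_unitmx hS; have [hs _] := hS.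
have e v : dotc y (S *m (invmx S *m v)) = dotc v y by rewrite mulKVmx// dotcC.
have := posdef_ge0 (y - invmx S *m w) hS.
have := posdef_ge0 (y - invmx S *m (- w)) hS.
rewrite !quadB_sym// !e dotcNl mulmxN.
have -> : quad S (- (invmx S *m w)) = quad S (invmx S *m w).
  by rewrite !quadE mulmxN dotcNl dotcNr opprK.
by case: (ger0P (dotc w y)) => ?; lra.
Qed.

Lemma attack_entries_bounded (R : realType) (m : nat) (Ra : 'M[R]_m)
    (a : R -> 'cV[R]_m) T :
  posdefmx Ra -> (forall t, 0 <= t -> quad Ra (a t) <= 1) ->
  entries_bounded [set r | 0 <= r <= T] a.
Proof.
move=> hRa ha; apply: entries_bounded_each => i.
pose w : 'cV[R]_m := delta_mx i 0.
(* This is [posdef_dotc_bound] for the basis vector [w], with [quad Ra (a r) <= 1]. *)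
exists ((1 + quad Ra (invmx Ra *m w)) / 2) => r /andP[r0 _].
have -> : a r i 0 = dotc w (a r) by rewrite /dotc trmx_delta -rowE mxE.
have := posdef_dotc_bound w (a r) hRa; have := ha r r0; lra.
Qed.

(* The integral form of the dynamics makes [V r := quad P (z r)] satisfy
   [V t - V s = \int_(s, t] (P (z t + z s))^T f r dr], with [f] bounded. While
   [V >= 1], replacing [z t + z s] by [2 z r] makes the integrand nonpositive, and
   the error is O(t - s) because [z] is Lipschitz; hence
   [V t - V s <= O((t - s)^2)], and no differentiation of [V] is needed. *)
Lemma lyapunov_forward_invariant (R : realType) (n m : nat) (A : 'M[R]_n)
    (B : 'M[R]_(n, m)) (Ra : 'M[R]_m) (P : 'M[R]_n) :
  P^T = P -> posdefmx Ra ->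
  (forall x a, 1 <= quad P x -> quad Ra a <= 1 ->
     dotc (P *m x) (A *m x + B *m a) <= 0) ->
  forward_invariant A B Ra (centered_ellipsoid P).
Proof.
move=> hP hRa hdec a z [_ ha] hz z0 T T0; rewrite /centered_ellipsoid /= in z0 *.
pose f r := A *m z r + B *m a r; pose S := [set r : R | 0 <= r <= T].
have zb : entries_bounded S z by apply: continuous_entries_bounded => //; case: hz.
have ab : entries_bounded S a by exact: attack_entries_bounded hRa ha.
have fb : entries_bounded S f.
  by apply: entries_boundedD; apply: entries_bounded_mulmx.
(* Difference of squares [(z t + z s)^T P (z t - z s)], valid since [P] is symmetric. *)
have quad_incr s t : quad P (z t) - quad P (z s)
    = dotc (P *m z t) (z t - z s) + dotc (P *m z s) (z t - z s).
  rewrite !(dotcDr, dotcNr) !quadE !(dotc_mulmx P) hP.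
  by rewrite (dotcC (P *m z s) (z t)) (dotc_mulmx P (z t)) hP; ring.
have [L hL] := entries_bounded_dotc (entries_bounded_mulmx P zb) fb.
have lip s t : 0 <= s -> s <= t -> t <= T ->
    quad P (z t) - quad P (z s) <= (L + L) * (t - s).
  move=> s0 st tT; rewrite quad_incr mulrDl.
  apply: lerD; apply: (trajectory_increment_le hz) => // r sr rt;
    apply: (le_trans (ler_norm _)); apply: hL; rewrite /S /=; lra.
(* After [t0] the form stays above 1, so the decrease condition holds on all of []t0, T]]; it
   remains to compare the values at [T] and [t0]. *)
have [t0 [t00 t0T Vt0 Vgt]] := last_exit_time T0 z0 lip.
have [K hK] := entries_bounded_dotc (entries_bounded_mulmx P fb) fb.
apply: le_trans Vt0.
apply: (@le_of_quadratic_increment _ (fun r => quad P (z r)) t0 T (K + K) t0T).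
move=> s t s0 st tT; have s00 := le_trans t00 s0.
rewrite quad_incr -dotcDl -mulmxDr expr2 mulrA.
apply: (trajectory_increment_le hz) => // r sr rt; rewrite -/(f r).
have decr : dotc (P *m z r) (f r) <= 0.
  by apply: hdec; [apply/ltW/Vgt; lra | apply: ha; lra].
(* Write [z t + z s = 2 z r + (z t - z r) - (z r - z s)]. The two corrections are bounded by
   applying the increment estimate again, with [w] fixed by the time [r]. *)
have incr1 : dotc (P *m f r) (z t - z r) <= K * (t - r).
  apply: (trajectory_increment_le hz); [lra|lra|] => q rq qt.
  by apply: (le_trans (ler_norm _)); apply: hK; rewrite /S /=; lra.
have incr2 : dotc (- (P *m f r)) (z r - z s) <= K * (r - s).
  apply: (trajectory_increment_le hz); [lra|lra|] => q rq qt.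
  apply: (le_trans (ler_norm _)); rewrite dotcNl normrN.
  by apply: hK; rewrite /S /=; lra.
have K0 : 0 <= K by apply: (le_trans (normr_ge0 _) (hK r r _ _)); rewrite /S /=; lra.
have -> : dotc (P *m (z t + z s)) (f r) = dotc (P *m f r) (z t - z r)
    + dotc (- (P *m f r)) (z r - z s) + 2 * dotc (P *m z r) (f r).
  have e x : dotc (P *m x) (f r) = dotc (P *m f r) x.
    by rewrite dotcC dotc_mulmx hP.
  by rewrite !e !(dotcDr, dotcNl, dotcNr); ring.
by nra.
Qed.

Theorem theorem10 (R : realType) (np nc nu ny mu my : nat)
  (G : primary_loop R np nc nu ny mu my)
  (Rzeta : 'M[R]_((np + nc) + (np + nc))) (zbar : 'cV[R]_((np + nc) + (np + nc)))
  (Rhat : 'M[R]_(np + nc))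
  (hRzeta : possemidefmx Rzeta) (hRhat : posdefmx Rhat)
  (hproj : proj_fst (ellipsoid Rzeta zbar) = ellipsoid Rhat (usubmx zbar))
  (hsafe : forall P : 'M[R]_((np + nc) + (np + nc)), posdefmx P ->
     proj_fst (centered_ellipsoid P) `<=` proj_fst (ellipsoid Rzeta zbar) ->
     centered_ellipsoid P `<=` ellipsoid Rzeta zbar)
  (eta : lmi_var R (np + nc) mu my) (Ra : 'M[R]_(nu + ny))
  (alpha beta delta : R)
  (hopt : optimal G Rhat (usubmx zbar) eta Ra alpha beta delta)
  (M N : 'M[R]_(np + nc))
  (hM : M \in unitmx) (hN : N \in unitmx)
  (hMN : M *m N^T = 1%:M - X eta *m Y eta)
  (K : secondary R (np + nc) mu my)
  (hK : change_of_variables G eta M N K)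
  (P : 'M[R]_((np + nc) + (np + nc)))
  (hP : P = Pi2 eta N *m invmx (Pi1 eta M)) :
  centered_ellipsoid P `<=` ellipsoid Rzeta zbar /\
  forward_invariant (calA G K) (calB (np + nc) G) Ra (centered_ellipsoid P).
Proof.
have [[[[hX hY] hRa [al0 be0 de0]] [hE hPeta hJ]] _] := hopt.
have hPi1 := Pi1_unitmx eta hM.
have hPPi : P *m Pi1 eta M = Pi2 eta N by rewrite hP mulmxKV.
have hcongr : (Pi1 eta M)^T *m P *m Pi1 eta M = Peta eta.
  by rewrite -mulmxA hPPi Pi1_Pi2.
have hPpos : posdefmx P by apply: (posdef_congr _ hPi1); rewrite hcongr.
have [hPs _] := hPpos; have hXpos := Peta_posdef_X hX hPeta.
split.
  apply: hsafe => //; rewrite hproj => _ [z Pz <-].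
  have [v hzv hv] := proj_fst_decomp z hPpos hXpos hPPi.
  rewrite /ellipsoid /= hzv.
  by apply: (lmi_projection hRhat hX de0 hJ); exact: le_trans hv Pz.
apply: lyapunov_forward_invariant => // x a hx ha.
(* In the coordinates [xi] the closed loop is paired with [P x] through [Aeta] and [Beta], as
   [lmi_decrease] requires. *)
pose xi := invmx (Pi1 eta M) *m x.
have ex : x = Pi1 eta M *m xi by rewrite mulKVmx.
have -> : dotc (P *m x) (calA G K *m x + calB (np + nc) G *m a)
    = dotc xi (Aeta G eta *m xi + Beta G eta *m a).
  rewrite -(Aeta_congr hY hK) -(Beta_congr G N hY) {1 2}ex (mulmxA P) hPPi.
  by rewrite -!mulmxA -mulmxDr dotc_tr dotcC.
apply: (lmi_decrease al0 be0 hE) => //.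
(* The congruence gives [quad (Peta eta) xi = quad P x], so [hx] transfers. *)
by rewrite -hcongr quadE -!mulmxA dotc_tr -!ex dotcC -quadE.
Qed.
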